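(* Let $d\ge1$, let $k(x,y)=e^{-\sigma\|x-y\|_2^2}$ be the Gaussian kernel on $[0,1]^d$ with $\sigma>0$, and let $P$ be a probability measure on $[0,1]^d$ with density $p$ satisfying $0<\inf p\le\sup p<\infty$. Set $c_\sigma=\max\{1,2e\sigma d\}$, $c_p=\sup_{z\in[0,1]^d}p(z)^{-1}$, $m(s)=\lceil 3c_\sigma s\rceil+2$ and $$c_0=\frac{\ln 3+(d-1)\ln2+\frac12\ln c_p+d\ln(3c_\sigma d)}{2d\ln3},\quad c_1=\frac{(2d-1)\ln2+d\ln(3c_\sigma)+\frac12\ln c_p}{d}+1,\quad c_2=\frac{(2d-1)\ln2+\frac12\ln c_p}{d}.$$ If $t\ge c:=\max\{c_0,c_1,c_2,1\}$, then $$\sup_{x\in[0,1]^d}\big\|L_kW^x_{m(td)}-k_x\big\|_k^2\le9\,(td)^{-2td}.$$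
   Context: Here $k_x(\cdot)=k(x,\cdot)$, $\|\cdot\|_k$ is the norm of the reproducing kernel Hilbert space $\mathcal{H}_k$ of $k$ on $[0,1]^d$, and $L_k$ is the integral operator $(L_kf)(y)=\int_{[0,1]^d}k(z,y)f(z)p(z)\,dz$ on $L^2([0,1]^d,P)$. For $x\in[0,1]$ let $w_m^x(z)=\sum_{i=1}^m\alpha_{x,i}z^{i-1}$, where $\alpha_x\in\mathbb{R}^m$ solves $H_m\alpha_x=(1,x,\dots,x^{m-1})^\top$ with the Hilbert matrix $H_m=\big(\frac1{i+j-1}\big)_{i,j=1}^m$. For $x=(x_1,\dots,x_d)\in[0,1]^d$ define $$W_m^x(z_1,\dots,z_d)=\Big(\prod_{i=1}^d w_m^{x_i}(z_i)\Big)\,p(z_1,\dots,z_d)^{-1}.$$ *)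

(* Defs.v *)
From HB Require Import structures.
From mathcomp Require Import all_boot all_order all_algebra.
From mathcomp Require Import all_classical all_reals all_analysis.
Set Implicit Arguments.
Unset Strict Implicit.
Unset Printing Implicit Defensive.
Import Order.TTheory GRing.Theory Num.Theory.
Import numFieldNormedType.Exports.
Local Open Scope classical_set_scope.
Local Open Scope ring_scope.

(* R^d, with the product of the Borel sigma-algebras. *)
Notation Rd R d := (d.-tuple (measurableTypeR R)).

Section lebesgue_measure_Rd.
Context (R : realType).

Definition cons_pair d (z : measurableTypeR R * Rd R d) : Rd R d.+1 :=
  [tuple of z.1 :: z.2].

Lemma measurable_cons_pair d : measurable_fun setT (@cons_pair d).
Proof. exact: measurable_cons. Qed.

Section cons_measure.
Context (d : nat) (mu : {sigma_finite_measure set (Rd R d) -> \bar R}).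
Local Open Scope ereal_scope.

Definition cons_measure : set (Rd R d.+1) -> \bar R :=
  pushforward ((@lebesgue_measure R) \x mu) (@cons_pair d).

Let cons_measure0 : cons_measure set0 = 0.
Proof. by rewrite /cons_measure /pushforward preimage_set0 measure0. Qed.

Let cons_measure_ge0 A : 0 <= cons_measure A.
Proof. by rewrite /cons_measure /pushforward measure_ge0. Qed.

Let cons_measure_semi_sigma_additive : semi_sigma_additive cons_measure.
Proof.
move=> F mF tF mUF; rewrite /cons_measure /pushforward preimage_bigcup.
have mc (A : set (Rd R d.+1)) : measurable A -> measurable (@cons_pair d @^-1` A).
  by move=> mA; rewrite -[X in measurable X]setTI; exact: measurable_cons_pair.
apply: measure_semi_sigma_additive.
- by move=> n; exact: mc.
- apply/trivIsetP => /= i j _ _ ij; rewrite -preimage_setI.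
  by move/trivIsetP : tF => /(_ _ _ _ _ ij) ->//; rewrite preimage_set0.
- by rewrite -preimage_bigcup; exact: mc.
Qed.

HB.instance Definition _ := isMeasure.Build _ _ _ cons_measure
  cons_measure0 cons_measure_ge0 cons_measure_semi_sigma_additive.

Let cons_measure_sigma_finite : sigma_finite setT cons_measure.
Proof.
pose uncons (t : Rd R d.+1) : measurableTypeR R * Rd R d :=
  (thead t, [tuple of behead t]).
have cons_pairK : cancel (@cons_pair d) uncons.
  by case=> x t; rewrite /uncons theadE; congr pair; exact/val_inj.
have m_uncons : measurable_fun setT uncons.
  apply/measurable_fun_pair; last exact: measurable_behead.
  exact: measurable_tnth.
have /sigma_finiteP[F [TF ndF Foo]] := sigma_finiteT (@lebesgue_measure R).
have /sigma_finiteP[G [TG ndG Goo]] := sigma_finiteT mu.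
exists (fun n => uncons @^-1` (F n `*` G n)).
  apply/esym; rewrite -subTset => t _.
  have [i _ Fi] : (\bigcup_i F i) (uncons t).1 by rewrite -TF.
  have [j _ Gj] : (\bigcup_i G i) (uncons t).2 by rewrite -TG.
  exists (maxn i j) => //; split.
  - by move: Fi; exact/subsetPset/ndF/leq_maxl.
  - by move: Gj; exact/subsetPset/ndG/leq_maxr.
move=> n; have [mF Foon] := Foo n; have [mG Goon] := Goo n; split.
  by rewrite -[X in measurable X]setTI; apply: m_uncons => //; exact: measurableX.
rewrite /cons_measure /pushforward -comp_preimage (_ : _ \o _ = id).
  by rewrite preimage_id product_measure1E// lte_mul_pinfty// ge0_fin_numE.
by apply/funext => z /=; exact: cons_pairK.
Qed.

HB.instance Definition _ := Measure_isSigmaFinite.Build _ _ _ cons_measure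
  cons_measure_sigma_finite.

End cons_measure.

Fixpoint lebesgue_measure_Rd d : {sigma_finite_measure set (Rd R d) -> \bar R} :=
  if d is d'.+1 then cons_measure (lebesgue_measure_Rd d')
  else \d_([tuple] : Rd R 0).


Local Open Scope ereal_scope.

Lemma lebesgue_measure_Rd_box d (A : 'I_d -> set (measurableTypeR R)) :
  (forall i, measurable (A i)) ->
  lebesgue_measure_Rd d [set z | forall i, A i (tnth z i)] =
  \prod_(i < d) lebesgue_measure (A i).
Proof.
elim: d A => [|d IHd] A mA.
  rewrite big_ord0 /= diracE mem_set// => -[].
  by [].
rewrite big_ord_recl -IHd//= /cons_measure /pushforward.
rewrite -product_measure1E//; last first.
  rewrite (_ : [set _ | _] = \bigcap_(i in [set: 'I_d])
      ((fun z : Rd R d => tnth z i) @^-1` A (lift ord0 i))).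
    apply: fin_bigcap_measurable => // i _.
    by rewrite -[X in measurable X]setTI; exact: measurable_tnth.
  by apply/seteqP; split => z /= zA i => [_|]; exact: zA.
congr (_ _); apply/seteqP; split => -[x z] /=.
  move=> xzA; split; first exact: (xzA ord0).
  by move=> i; have := xzA (lift ord0 i); rewrite /cons_pair tnthS.
move=> [xA zA] i; have [->//|] := eqVneq i ord0.
by case: (unliftP ord0 i) => [j ->|->]; rewrite ?eqxx// => _; rewrite tnthS.
Qed.

End lebesgue_measure_Rd.

(* A Hilbert space of functions X -> R in which evaluation at x is the inner
   product with the section k(x, _).  Elements of the space are identified with
   functions through the linear injection rkhs_fun; completeness comes from
   completeNormedModType.  Such a space is unique up to isometry (Moore-Aronszajn). *)
Record rkhs (R : realType) (X : Type) (k : X -> X -> R) := Rkhs {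
  rkhs_space :> completeNormedModType R;
  rkhs_dot : {dot rkhs_space for idfun};
  rkhs_fun : rkhs_space -> X -> R;
  rkhs_section : X -> rkhs_space;
  rkhs_dotE : forall h, rkhs_dot h h = `|h| ^+ 2;
  rkhs_funP : forall (a : R) (g h : rkhs_space) (x : X),
    rkhs_fun (a *: g + h) x = a * rkhs_fun g x + rkhs_fun h x;
  rkhs_fun_inj : injective rkhs_fun;
  rkhs_sectionE : forall x, rkhs_fun (rkhs_section x) = k x;
  rkhs_reproducing : forall h x, rkhs_fun h x = rkhs_dot h (rkhs_section x) }.

(* The norm of f in H.  The set below has at most one element, by rkhs_fun_inj;
   it is empty, and the norm is +oo, when f does not belong to H. *)
Definition rkhs_norm (R : realType) (X : Type) (k : X -> X -> R) (H : rkhs k)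
    (f : X -> R) : \bar R :=
  ereal_inf [set `|h|%:E | h in [set h : H | rkhs_fun h = f]].

Section interpolation.
Context (R : realType) (d : nat).

Definition unit_cube : set (Rd R d) :=
  [set z | forall i, 0 <= (tnth z i : R) <= 1].

Definition gaussian (sigma : R) (x y : Rd R d) : R :=
  expR (- sigma * \sum_(i < d) ((tnth x i : R) - tnth y i) ^+ 2).

Definition has_density (P : set (Rd R d) -> \bar R) (p : Rd R d -> R) :=
  measurable_fun unit_cube p /\
  forall A, measurable A ->
    P A = (\int[lebesgue_measure_Rd R d]_(z in A `&` unit_cube) (p z)%:E)%E.

Definition integral_operator (k : Rd R d -> Rd R d -> R) (p f : Rd R d -> R)
    (y : Rd R d) : R :=
  \int[lebesgue_measure_Rd R d]_(z in unit_cube) (k z y * f z * p z).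

(* Row i and column j, counted from 0, hold 1 / (i + j + 1). *)
Definition hilbert_mx m : 'M[R]_m := \matrix_(i, j) (i + j).+1%:R^-1.

Definition moments m (x : R) : 'cV[R]_m := \col_i x ^+ i.

(* w_m^x, from the solution alpha of H_m alpha = (1, x, ..., x^(m-1))^T. *)
Definition weight1 m (alpha : 'cV[R]_m) (z : R) : R :=
  \sum_(i < m) alpha i 0 * z ^+ i.

Definition weight m (alpha : R -> 'cV[R]_m) (p : Rd R d -> R) (x z : Rd R d) : R :=
  (\prod_(i < d) weight1 (alpha (tnth x i)) (tnth z i)) * (p z)^-1.

End interpolation.

Section constants.
Context (R : realType) (d : nat) (sigma : R) (p : Rd R d -> R).

Definition c_sigma : R := Num.max 1 (2 * expR 1 * sigma * d%:R).

Definition c_p : R := sup [set (p z)^-1 | z in @unit_cube R d].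

Definition degree (s : R) : nat := (`|Num.ceil (3 * c_sigma * s)| + 2)%N.

Definition c0 : R :=
  (ln 3 + (d%:R - 1) * ln 2 + 2^-1 * ln c_p + d%:R * ln (3 * c_sigma * d%:R))
  / (2 * d%:R * ln 3).

Definition c1 : R :=
  ((2 * d%:R - 1) * ln 2 + d%:R * ln (3 * c_sigma) + 2^-1 * ln c_p) / d%:R + 1.

Definition c2 : R := ((2 * d%:R - 1) * ln 2 + 2^-1 * ln c_p) / d%:R.

Definition c_threshold : R := Num.max (Num.max c0 c1) (Num.max c2 1).

End constants.

(* Main.v *)
(* The weight [W_m^x] reproduces at [x] every polynomial of degree less than [m] in each
   variable, so the signed measure [mu = W_m^x dP - delta_x] annihilates these.  Since
   [|L_k W_m^x - k_x|_k^2] is the double integral of [k] against [mu], and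
   [k(z, z') = exp(- sigma |z - z'|^2)], expanding the exponential to order [m] leaves
   only the remainder: each monomial of [|z - z'|^(2 n)], [n < m], has degree less than
   [m] in [z] or in [z'].  Hence the squared error is at most
   [|mu|^2 (sigma d)^m / m!], where [|mu| <= 1 + m^d] because
   [|w_m^x|_{L^1}^2 <= |w_m^x|_{L^2}^2 = w_m^x(x) <= m^2].  The last bound is the
   inequality [q(x)^2 <= m^2 int_0^1 q^2] for polynomials of degree less than [m].

   To integrate [k_z] inside an abstract RKHS, the measure is replaced by its Riemann sums
   on the grid of step [1 / (n + 1)]: these are finite combinations of sections [k_z], the
   same Taylor argument shows that they are Cauchy, and their moments converge. *)
Require Import Defs.
From HB Require Import structures.
From mathcomp Require Import all_boot all_order all_algebra.
From mathcomp Require Import all_classical all_reals all_analysis.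
From mathcomp Require Import measurable_realfun ring lra.
Set Implicit Arguments.
Unset Strict Implicit.
Unset Printing Implicit Defensive.
Import Order.TTheory GRing.Theory Num.Theory.
Import numFieldNormedType.Exports.
Local Open Scope classical_set_scope.
Local Open Scope ring_scope.

(** * Point evaluation of polynomials in L^2[0,1] *)

Section PolynomialIntegral.
Context {R : realFieldType}.
Implicit Types (p q : {poly R}) (a b x : R) (m : nat).

(** At [i = 0] the coefficient is a quotient by [0], hence [0]: this is the antiderivative that
    vanishes at [0]. *)
Definition primitive p : {poly R} :=
  \poly_(i < (size p).+1) (p`_i.-1 / i%:R).

Lemma coef_primitive p i : (primitive p)`_i = p`_i.-1 / i%:R.
Proof.
rewrite coef_poly; case: ltnP => // pi; case: i pi => [|i] pi; first by rewrite invr0 mulr0.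
by rewrite nth_default ?mul0r.
Qed.

Lemma deriv_primitive p : (primitive p)^`() = p.
Proof.
by apply/polyP => i; rewrite coef_deriv coef_primitive /= -[LHS]mulr_natr divfK ?pnatr_eq0.
Qed.

Lemma primitive_deriv p : primitive p^`() = p - (p`_0)%:P.
Proof.
apply/polyP => -[|i]; rewrite coef_primitive coefB coefC /=.
  by rewrite invr0 mulr0 subrr.
by rewrite coef_deriv -[X in X / _]mulr_natr mulfK ?subr0// pnatr_eq0.
Qed.

Fact primitive_is_linear : linear primitive.
Proof.
move=> c p q; apply/polyP => i.
by rewrite coefD coefZ !coef_primitive coefD coefZ mulrDl mulrA.
Qed.
HB.instance Definition _ := GRing.isLinear.Build R {poly R} {poly R} _ primitive
  primitive_is_linear.

Definition poly_int a b p : R := (primitive p).[b] - (primitive p).[a].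

Fact poly_int_is_linear a b : scalar (poly_int a b).
Proof. by move=> c p q; rewrite /poly_int linearP /= !(hornerD, hornerZ); ring. Qed.
HB.instance Definition _ a b := GRing.isLinear.Build R {poly R} R _ (poly_int a b)
  (poly_int_is_linear a b).

Lemma poly_int_deriv a b p : poly_int a b p^`() = p.[b] - p.[a].
Proof. by rewrite /poly_int primitive_deriv !hornerE; ring. Qed.

Lemma poly_int01 p m : (size p <= m)%N ->
  poly_int 0 1 p = \sum_(i < m) p`_i / i.+1%:R.
Proof.
move=> pm; rewrite /poly_int horner_coef0 coef_primitive invr0 mulr0 subr0.
rewrite (@horner_coef_wide _ m.+1); last by rewrite (leq_trans (size_poly _ _)).
rewrite big_ord_recl coef_primitive invr0 mulr0 mul0r add0r.
by apply: eq_bigr => i _; rewrite coef_primitive expr1n mulr1.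
Qed.

Lemma poly_int01Xn n : poly_int 0 1 'X^n = n.+1%:R^-1.
Proof.
rewrite (@poly_int01 _ n.+1) ?size_polyXn// big_ord_recr /= coefXn eqxx mul1r.
by rewrite big1 ?add0r// => i _; rewrite coefXn ltn_eqF// mul0r.
Qed.

Lemma poly_int01C (c : R) : poly_int 0 1 c%:P = c.
Proof. by rewrite (@poly_int01 _ 1) ?size_polyC_leq1// big_ord1 coefC divr1. Qed.

(** Chain rule: [primitive p \Po l] is an antiderivative of [(b - a) *: (p \Po l)]. The integral is
    oriented, so [b < a] is allowed. *)
Lemma poly_int_affine a b p :
  poly_int a b p = (b - a) * poly_int 0 1 (p \Po (a%:P + (b - a) *: 'X)).
Proof.
set l := (X in _ \Po X).
have dl : l^`() = (b - a)%:P by rewrite derivD derivC derivZ derivX add0r alg_polyC.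
have -> : (b - a) * poly_int 0 1 (p \Po l) = poly_int 0 1 (primitive p \Po l)^`().
  by rewrite deriv_comp deriv_primitive dl [_ * _%:P]mulrC mul_polyC linearZ.
have lE x : l.[x] = a + (b - a) * x by rewrite /l !(hornerD, hornerC, hornerZ, hornerX).
by rewrite poly_int_deriv !horner_comp !lE mulr0 addr0 mulr1 (addrC a) subrK.
Qed.

Lemma poly_int_split a b c p : poly_int a c p = poly_int a b p + poly_int b c p.
Proof. by rewrite /poly_int; ring. Qed.

(** In the monomial basis the squared L^2 norm is the quadratic form of the Hilbert matrix. *)
Lemma poly_int01_sqr q m : (size q <= m)%N ->
  poly_int 0 1 (q * q) = \sum_(i < m) \sum_(j < m) q`_i * q`_j / (i + j).+1%:R.
Proof.
move=> qm; have qE : q = \sum_(i < m) q`_i *: 'X^i.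
  by rewrite -poly_def; apply/esym/polyP => i; rewrite coef_poly;
    case: ltnP => // mi; rewrite nth_default// (leq_trans qm).
rewrite {1 2}qE mulr_suml linear_sum /=; apply: eq_bigr => i _.
rewrite mulr_sumr linear_sum /=; apply: eq_bigr => j _.
by rewrite -scalerAl -scalerAr -exprD !linearZ /= poly_int01Xn mulrA.
Qed.

(* In the step from degree [m] to [M = m + 1], the Blaschke-type multiplier
   [X^i |-> (i - M) / (i + M + 1) X^i] kills [X^M], scales the constant term by
   [- M / (M + 1)] and contracts L^2[0,1], since the Gram form [1 / (i + j + 1)]
   decreases by [(2 M + 1) (sum_i q_i / (i + M + 1))^2]. *)
Lemma coef0_le_gram m (q : nat -> R) :
  q 0%N ^+ 2 <= m.+1%:R ^+ 2 *
    \sum_(i < m.+1) \sum_(j < m.+1) q i * q j / (i + j).+1%:R.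
Proof.
elim: m q => [|m IHm] q.
  by rewrite !big_ord1/= expr1n mul1r divr1.
set M := m.+1 in IHm *.
pose u (i : nat) : R := (i%:R - M%:R) / (i + M).+1%:R.
have n0 (k : nat) : k.+1%:R != 0 :> R by rewrite pnatr_eq0.
have uM : u M = 0 by rewrite /u subrr mul0r.
have := IHm (fun i => u i * q i).
have -> : \sum_(i < M) \sum_(j < M) u i * q i * (u j * q j) / (i + j).+1%:R =
  \sum_(i < M.+1) \sum_(j < M.+1) u i * q i * (u j * q j) / (i + j).+1%:R.
  rewrite [RHS]big_ord_recr /= [X in _ + X]big1 ?addr0; last first.
    by move=> j _; rewrite uM !mul0r.
  by apply: eq_bigr => i _; rewrite [RHS]big_ord_recr /= uM mul0r mulr0 mul0r addr0.
(* Entrywise this is [(i - M) (j - M) = (i + M + 1) (j + M + 1) - (2 M + 1) (i + j + 1)], divided by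
   the three denominators. *)
have -> : \sum_(i < M.+1) \sum_(j < M.+1) u i * q i * (u j * q j) / (i + j).+1%:R =
  \sum_(i < M.+1) \sum_(j < M.+1) q i * q j / (i + j).+1%:R
  - (2 * M%:R + 1) * (\sum_(i < M.+1) q i / (i + M).+1%:R) ^+ 2.
  rewrite expr2 mulr_suml mulr_sumr -sumrB; apply: eq_bigr => i _.
  rewrite mulr_sumr mulr_sumr -sumrB; apply: eq_bigr => j _.
  have nD (k l : nat) : (k + l).+1%:R = k%:R + l%:R + 1 :> R by rewrite -natr1 natrD.
  move: (n0 (i + j)%N) (n0 (i + M)%N) (n0 (j + M)%N); rewrite /u !nD.
  move: (i%:R : R) (j%:R : R) (M%:R : R) => x y z h1 h2 h3.
  by field; rewrite h1 h2 h3.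
set S := \sum_(_ < _) _; set T := \sum_(_ < _) _.
rewrite /u add0n sub0r => h.
have hT : 0 <= (2 * M%:R + 1) * T ^+ 2.
  by rewrite mulr_ge0 ?sqr_ge0// addr_ge0// mulr_ge0.
have {h} : (M%:R / M.+1%:R) ^+ 2 * q 0%N ^+ 2 <= M%:R ^+ 2 * S.
  rewrite -exprMn (le_trans (_ : _ <= (- M%:R / M.+1%:R * q 0%N) ^+ 2)) //.
    by rewrite !mulNr sqrrN.
  by rewrite (le_trans h)// ler_wpM2l ?sqr_ge0// gerBl.
by rewrite exprMn -mulrA ler_pM2l ?exprVn ?ler_pdivrMl ?exprn_gt0 ?ltr0n.
Qed.

Lemma sqr_horner0_le q m : (0 < m)%N -> (size q <= m)%N ->
  q.[0] ^+ 2 <= m%:R ^+ 2 * poly_int 0 1 (q * q).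
Proof.
case: m => // m _ qm; rewrite horner_coef0 (poly_int01_sqr qm).
exact: coef0_le_gram m (fun i => q`_i).
Qed.

(* [x] is an endpoint of both [0, x] and [x, 1]: rescale the estimate at an endpoint
   to each of them, and add the results with weights [x] and [1 - x]. *)
Lemma sqr_horner_le q m x : (0 < m)%N -> (size q <= m)%N -> 0 <= x <= 1 ->
  q.[x] ^+ 2 <= m%:R ^+ 2 * poly_int 0 1 (q * q).
Proof.
move=> m0 qm /andP[x0 x1].
have endpoint b : q.[x] ^+ 2 <=
    m%:R ^+ 2 * poly_int 0 1 ((q * q) \Po (x%:P + (b - x) *: 'X)).
  rewrite comp_polyM; set l := (X in _ \Po X).
  have -> : q.[x] = (q \Po l).[0].
    by rewrite horner_comp /l !hornerE.
  apply: sqr_horner0_le => //; apply: leq_trans qm.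
  have [->|q0] := eqVneq q 0; first by rewrite comp_poly0.
  have sl : (size l <= 2)%N.
    rewrite (leq_trans (size_polyD _ _))// geq_max (leq_trans (size_polyC_leq1 _))//=.
    by rewrite (leq_trans (size_scale_leq _ _))// size_polyX.
  rewrite (leq_trans (size_comp_poly_leq _ _))// -(prednK (n := size q)) ?size_poly_gt0//.
  rewrite ltnS -{2}[(size q).-1]muln1 leq_mul2l.
  by case: (size l) sl => [|[|[]]]//= _; rewrite orbT.
rewrite (poly_int_split 0 x 1) mulrDr.
have -> : poly_int 0 x (q * q) = - poly_int x 0 (q * q) by rewrite /poly_int; ring.
rewrite (poly_int_affine x 0) (poly_int_affine x 1).
have h0 := endpoint 0; have h1 := endpoint 1.
move: h0 h1; set A := poly_int _ _ _; set B := poly_int _ _ _ => h0 h1.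
have {}h0 := ler_wpM2l x0 h0.
have {}h1 : (1 - x) * q.[x] ^+ 2 <= (1 - x) * (m%:R ^+ 2 * B).
  by rewrite ler_wpM2l ?subr_ge0.
by move: h0 h1; rewrite sub0r; lra.
Qed.

(** The estimate at [x] reads [w(x)^2 <= m^2 w(x)]; divide by [w(x)] when it is positive. *)
Lemma evaluation_norm_le (w : {poly R}) m x : (0 < m)%N -> (size w <= m)%N ->
  0 <= x <= 1 -> poly_int 0 1 (w * w) = w.[x] -> poly_int 0 1 (w * w) <= m%:R ^+ 2.
Proof.
move=> m0 wm x01 wE; have := sqr_horner_le m0 wm x01; rewrite wE.
have [w0 _|w0] := leP w.[x] 0; first by rewrite (le_trans w0)// sqr_ge0.
by rewrite expr2 ler_pM2r.
Qed.

End PolynomialIntegral.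

(** * The Gaussian kernel against discrete measures with small moments *)

Section ExpTaylor.
Context {R : realType}.
Implicit Types (u : R) (K : nat).

Definition exp_taylor K : {poly R} := \poly_(n < K) ((-1) ^+ n / n`!%:R).

Lemma deriv_exp_taylor K : (exp_taylor K.+1)^`() = - exp_taylor K.
Proof.
apply/polyP => i; rewrite coef_deriv coefN !coef_poly ltnS.
case: ltnP => _; last by rewrite mul0rn oppr0.
by rewrite exprS factS natrM invfM mulrA mulN1r -[LHS]mulr_natr mulrAC divfK ?pnatr_eq0// mulNr.
Qed.

Lemma ge0_of_derive (f df : R -> R) : (forall x : R, is_derive x (1 : R) f (df x)) ->
  f 0 = 0 -> (forall x, 0 <= x -> 0 <= df x) -> forall x, 0 <= x -> 0 <= f x.
Proof.
move=> fd f0 df0 x x0.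
have [|c] := MVT_segment x0 (fun y _ => fd y).
  by apply: derivable_within_continuous => y _; exact: ex_derive.
rewrite in_itv/= f0 !subr0 => /andP[c0 _] ->.
by rewrite mulr_ge0// df0.
Qed.

(** Induction on [K]: the signed remainder of order [K + 1] vanishes at [0], and its derivative is
    the signed remainder of order [K]. *)
Lemma exp_taylor_rem K u : 0 <= u ->
  0 <= (-1) ^+ K * (expR (- u) - (exp_taylor K).[u]) <= u ^+ K / K`!%:R.
Proof.
elim: K u => [|K IH] u u0.
  rewrite /exp_taylor poly_def big_ord0 horner0 subr0 mul1r fact0 divr1 expr0.
  by rewrite expR_ge0 -expR0 ler_expR oppr_le0.
pose f u := (-1) ^+ K.+1 * (expR (- u) - (exp_taylor K.+1).[u]).
pose df u := (-1) ^+ K * (expR (- u) - (exp_taylor K).[u]).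
have fd (x : R) : is_derive x (1 : R) f (df x).
  rewrite /f; apply: is_derive_eq; rewrite deriv_exp_taylor hornerN /df exprS.
  by rewrite /GRing.scale/=; ring.
have f0 : f 0 = 0.
  rewrite /f oppr0 expR0 horner_coef0 coef_poly/= expr0 fact0 divr1 subrr mulr0//.
apply/andP; split.
  by apply: (ge0_of_derive fd f0) => // x /IH/andP[].
rewrite -subr_ge0.
pose p : {poly R} := (K.+1`!%:R)^-1 *: 'X^(K.+1).
have pE x : p.[x] = x ^+ K.+1 / K.+1`!%:R by rewrite hornerZ hornerXn mulrC.
rewrite -pE; apply: (@ge0_of_derive (fun x => p.[x] - f x)
  (fun x => x ^+ K / K`!%:R - df x)) => //.
- move=> x; apply: is_derive_eq; congr (_ - _).
  rewrite derivZ derivXn hornerZ hornerMn hornerXn factS natrM invfM -[X in _ * X]mulr_natr.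
  have : K.+1%:R != 0 :> R by rewrite pnatr_eq0.
  by move: K.+1%:R K`!%:R^-1 => k v k0; field.
- by rewrite pE f0 expr0n mul0r subr0.
- by move=> x /IH/andP[_]; rewrite subr_ge0.
Qed.

Lemma exp_taylor_bound K u : 0 <= u ->
  `|expR (- u) - (exp_taylor K).[u]| <= u ^+ K / K`!%:R.
Proof.
move=> /(exp_taylor_rem K)/andP[r0 rle].
by have := ger0_norm r0; rewrite normrM normrX normrN1 expr1n mul1r => ->.
Qed.

End ExpTaylor.

(** * The Gaussian quadratic form of a discrete signed measure *)

Section GramBound.
Context {R : realType} {d : nat}.
Implicit Types (a b : seq 'I_d) (x y z : Rd R d).

(** The list holds the variables with repetition: the degree is [size a], and multiplying by a
    variable is a cons. *)
Definition monomial a z : R := \prod_(r <- a) tnth z r.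

Definition sqdist x y : R := \sum_(i < d) ((tnth x i : R) - tnth y i) ^+ 2.

Lemma gaussianE sigma x y : gaussian sigma x y = expR (- (sigma * sqdist x y)).
Proof. by rewrite /gaussian mulNr. Qed.

Lemma sqdist_ge0 x y : 0 <= sqdist x y.
Proof. by apply: sumr_ge0 => i _; rewrite sqr_ge0. Qed.

Lemma sqdist_le x y : unit_cube x -> unit_cube y -> sqdist x y <= d%:R.
Proof.
move=> x01 y01; rewrite -[leRHS]mulr1 -[in leRHS](card_ord d) mulr_natl -sumr_const.
apply: ler_sum => i _; move: (x01 i) (y01 i).
move: (tnth x i : R) (tnth y i : R) => u v /andP[? ?] /andP[? ?].
by rewrite -real_normK ?num_real// expr_le1// ler_norml; lra.
Qed.

Lemma normr_monomial_le1 a z : unit_cube z -> `|monomial a z| <= 1.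
Proof.
move=> z01; rewrite normr_prod; apply: prodr_ile1 => i _ /=.
by have /andP[? ?] := z01 i; rewrite normr_ge0 ger0_norm.
Qed.

Context {I : finType} (c : I -> R) (z : I -> Rd R d) (K : nat) (C delta : R).
Hypothesis z01 : forall i, unit_cube (z i).
Hypothesis cC : \sum_i `|c i| <= C.
Hypothesis mom : forall a, (size a < K)%N -> `|\sum_i c i * monomial a (z i)| <= delta.

(** The lists [a] and [b] collect the variables that come out of expanding powers of [sqdist]. *)
Let form a b n := \sum_i \sum_j c i * c j * monomial a (z i) * monomial b (z j)
  * sqdist (z i) (z j) ^+ n.

(* Every monomial of [|x - y|^(2 n)] has degree less than [K] in [x] or in [y]
   when [n < K], so one of the two moments is at most [delta]. *)
Lemma normr_form_le n a b : (size a + size b + n.*2 < K.*2)%N ->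
  `|form a b n| <= (4 * d%:R) ^+ n * (delta * C).
Proof.
have C0 : 0 <= C by apply: le_trans cC; apply: sumr_ge0.
have momC s : `|\sum_i c i * monomial s (z i)| <= C.
  apply: le_trans cC; apply: (le_trans (ler_norm_sum _ _ _)).
  by apply: ler_sum => i _; rewrite normrM ler_piMr// normr_monomial_le1.
elim: n a b => [|n IH] a b.
  rewrite addn0 mul1r => ab.
  have -> : form a b 0 = (\sum_i c i * monomial a (z i)) * (\sum_j c j * monomial b (z j)).
    rewrite /form mulr_suml; apply: eq_bigr => i _.
    by rewrite mulr_sumr; apply: eq_bigr => j _; rewrite expr0; ring.
  have [aK|Ka] := ltnP (size a) K.
    by rewrite normrM ler_pM// mom.
  have bK : (size b < K)%N by rewrite -(ltn_add2l K) addnn (leq_ltn_trans _ ab)// leq_add2r.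
  by rewrite normrM [delta * C]mulrC ler_pM// mom.
move=> ab.
(* One factor is expanded by [(x_r - y_r)^2 = x_r^2 - 2 x_r y_r + y_r^2]. Each term trades one power
   of [sqdist] for two more variables, so the degree condition persists; the absolute coefficients
   add up to [4] for each of the [d] coordinates. *)
have -> : form a b n.+1 = \sum_(r < d) (form [:: r, r & a] b n
    - form (r :: a) (r :: b) n *+ 2 + form a [:: r, r & b] n).
  rewrite /form; under [RHS]eq_bigr do rewrite -sumrMnl -sumrB -big_split/=.
  rewrite [RHS]exchange_big/=; apply: eq_bigr => i _.
  under [RHS]eq_bigr do rewrite -sumrMnl -sumrB -big_split/=.
  rewrite [RHS]exchange_big/=; apply: eq_bigr => j _.
  rewrite exprSr {2}/sqdist !mulr_sumr; apply: eq_bigr => r _.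
  by rewrite /monomial !big_cons; ring.
have {}IH a' b' : (size a' + size b' = (size a + size b).+2)%N ->
    `|form a' b' n| <= (4 * d%:R) ^+ n * (delta * C).
  by move=> ab'; apply: IH; rewrite ab'; move: ab; rewrite doubleS !addSn !addnS.
apply: (le_trans (ler_norm_sum _ _ _)).
have -> : (4 * d%:R) ^+ n.+1 * (delta * C) = \sum_(r < d) 4 * ((4 * d%:R) ^+ n * (delta * C)).
  by rewrite sumr_const card_ord -[RHS]mulr_natl exprS; ring.
apply: ler_sum => r _.
have h1 := IH [:: r, r & a] b erefl.
have /IH h2 : (size (r :: a) + size (r :: b) = (size a + size b).+2)%N by rewrite /= addnS.
have /IH h3 : (size a + size [:: r, r & b] = (size a + size b).+2)%N by rewrite /= !addnS.
rewrite (le_trans (ler_normD _ _))//.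
have := ler_normB (form [:: r, r & a] b n) (form (r :: a) (r :: b) n *+ 2).
by rewrite normrMn; lra.
Qed.

(** The kernel splits into a Taylor polynomial and a remainder. On the cube the remainder is at most
    [(sigma d)^K / K!], against total mass [C] in each argument; the term of order [n < K] of the
    polynomial is a multiple of [form [::] [::] n]. *)
Lemma gram_le sigma : 0 <= sigma ->
  \sum_i \sum_j c i * c j * gaussian sigma (z i) (z j) <=
  C ^+ 2 * ((sigma * d%:R) ^+ K / K`!%:R) +
  delta * C * \sum_(n < K) (4 * sigma * d%:R) ^+ n / n`!%:R.
Proof.
move=> s0; have C0 : 0 <= C by apply: le_trans cC; apply: sumr_ge0.
set E := (sigma * d%:R) ^+ K / K`!%:R.
pose T i j := (exp_taylor K).[sigma * sqdist (z i) (z j)].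
have -> : \sum_i \sum_j c i * c j * gaussian sigma (z i) (z j) =
    \sum_i \sum_j c i * c j * (gaussian sigma (z i) (z j) - T i j) +
    \sum_i \sum_j c i * c j * T i j.
  rewrite -big_split/=; apply: eq_bigr => i _; rewrite -big_split/=.
  by apply: eq_bigr => j _; rewrite -mulrDr subrK.
apply: lerD.
  have : \sum_i \sum_j `|c i| * `|c j| * E <= C ^+ 2 * E.
    under eq_bigr do rewrite -mulr_suml -mulr_sumr.
    rewrite -2!mulr_suml expr2 ler_wpM2r ?ler_pM ?sumr_ge0//.
    by rewrite divr_ge0// exprn_ge0// mulr_ge0.
  apply: le_trans; apply: ler_sum => i _; apply: ler_sum => j _.
  rewrite (le_trans (ler_norm _))// !normrM ler_wpM2l// gaussianE.
  rewrite (le_trans (exp_taylor_bound _ _)) ?mulr_ge0 ?sqdist_ge0//.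
  by rewrite ler_wpM2r ?invr_ge0// lerXn2r ?nnegrE ?mulr_ge0 ?sqdist_ge0// ler_wpM2l// sqdist_le.
have -> : \sum_i \sum_j c i * c j * T i j =
    \sum_(n < K) (-1) ^+ n / n`!%:R * sigma ^+ n * form [::] [::] n.
  transitivity (\sum_i \sum_j \sum_(n < K)
      (-1) ^+ n / n`!%:R * sigma ^+ n * (c i * c j * 1 * 1 * sqdist (z i) (z j) ^+ n)).
    apply: eq_bigr => i _; apply: eq_bigr => j _.
    rewrite /T horner_poly mulr_sumr; apply: eq_bigr => n _.
    by rewrite exprMn; ring.
  under eq_bigr do rewrite exchange_big/=.
  rewrite exchange_big/=; apply: eq_bigr => n _.
  rewrite mulr_sumr; apply: eq_bigr => i _; rewrite mulr_sumr; apply: eq_bigr => j _.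
  by rewrite /monomial !big_nil.
rewrite mulr_sumr; apply: ler_sum => n _.
rewrite (le_trans (ler_norm _))// normrM.
have -> : delta * C * ((4 * sigma * d%:R) ^+ n / n`!%:R) =
    (sigma ^+ n / n`!%:R) * ((4 * d%:R) ^+ n * (delta * C)).
  by rewrite !exprMn; ring.
rewrite ler_pM//.
  by rewrite !normrM normrX normrN1 expr1n mul1r normfV !ger0_norm ?exprn_ge0// mulrC.
by apply: normr_form_le; rewrite /= ltn_double.
Qed.

End GramBound.

(** * Kernel embeddings of discrete measures and their limits *)

Section DiscreteMeasures.
Context {R : realType} {d : nat} (sigma : R) (sigma0 : 0 <= sigma).
Let X : Type := @unit_cube R d.
Context (H : rkhs (fun x y : X => gaussian sigma (val x) (val y))).

(** The kernel mean embedding of the signed measure with mass [c i] at [z i]. *)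
Definition embedding (I : finType) (c : I -> R) (z : I -> X) : H :=
  \sum_i c i *: rkhs_section H (z i).

Definition moment (I : finType) (c : I -> R) (z : I -> X) (a : seq 'I_d) : R :=
  \sum_i c i * monomial a (val (z i)).

Lemma rkhs_dot_section (x y : X) :
  rkhs_dot H (rkhs_section H x) (rkhs_section H y) = gaussian sigma (val x) (val y).
Proof. by rewrite -rkhs_reproducing rkhs_sectionE. Qed.

Lemma rkhs_dot_embedding (I : finType) (c : I -> R) (z : I -> X) (y : X) :
  rkhs_dot H (embedding c z) (rkhs_section H y) =
  \sum_i c i * gaussian sigma (val (z i)) (val y).
Proof.
rewrite /embedding linear_sumlz; apply: eq_bigr => i _.
by rewrite linearZl_LR /= rkhs_dot_section.
Qed.

Lemma sqr_norm_embedding (I : finType) (c : I -> R) (z : I -> X) :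
  `|embedding c z| ^+ 2 =
  \sum_i \sum_j c i * c j * gaussian sigma (val (z i)) (val (z j)).
Proof.
rewrite -rkhs_dotE {2}/embedding linear_sumr exchange_big; apply: eq_bigr => j _.
rewrite linearZr_LR /= rkhs_dot_embedding mulr_sumr; apply: eq_bigr => i _.
by rewrite mulrA [c j * _]mulrC.
Qed.

Lemma unit_cube_val (x : X) : unit_cube (val x).
Proof. exact: set_valP. Qed.

Definition taylor_const K : R := \sum_(n < K) (4 * sigma * d%:R) ^+ n / n`!%:R.

(** The difference embeds the signed measure on the disjoint union [I + J] with the masses on [J]
    negated, so [gram_le] applies with total mass [C + C']. *)
Lemma sqr_dist_embedding_le (I J : finType) (c : I -> R) (c' : J -> R)
    (z : I -> X) (z' : J -> X) K (C C' delta : R) :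
  \sum_i `|c i| <= C -> \sum_j `|c' j| <= C' ->
  (forall a, (size a < K)%N -> `|moment c z a - moment c' z' a| <= delta) ->
  `|embedding c z - embedding c' z'| ^+ 2 <=
  (C + C') ^+ 2 * ((sigma * d%:R) ^+ K / K`!%:R) + delta * (C + C') * taylor_const K.
Proof.
move=> cC cC' mom.
pose b (s : I + J) := match s with inl i => c i | inr j => - c' j end.
pose t (s : I + J) := match s with inl i => z i | inr j => z' j end.
have -> : embedding c z - embedding c' z' = embedding b t.
  rewrite /embedding big_sumType/= -sumrN; congr (_ + _).
  by apply: eq_bigr => j _; rewrite scaleNr.
rewrite sqr_norm_embedding; apply: (gram_le (z := val \o t)) => //.
- by move=> s; exact: unit_cube_val.
- rewrite big_sumType/= lerD//.
  by under eq_bigr do rewrite normrN.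
- move=> a /mom; congr (`|_| <= _); rewrite big_sumType/=; congr (_ + _).
  by rewrite -sumrN; apply: eq_bigr => j _; rewrite mulNr.
Qed.

Context (I : nat -> finType) (c : forall n, I n -> R) (z : forall n, I n -> X).
Context (C : R) (M : seq 'I_d -> R).
Hypothesis cC : \forall n \near \oo, \sum_i `|@c n i| <= C.
Hypothesis momM : forall a, moment (@c n) (@z n) a @[n --> \oo] --> M a.

Let h n := embedding (@c n) (@z n).

(** Only finitely many lists are shorter than [K], so the convergence of the moments is uniform over
    them. *)
Lemma near_moment K (delta : R) : 0 < delta ->
  \forall n \near \oo, forall a, (size a < K)%N ->
    `|moment (@c n) (@z n) a - M a| <= delta.
Proof.
move=> delta0.
have : \forall n \near \oo, forall k : 'I_K, forall a : k.-tuple 'I_d,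
    `|moment (@c n) (@z n) a - M a| <= delta.
  apply: filter_forall => k; apply: filter_forall => a.
  by have /cvgrPdistC_le/(_ _ delta0) := @momM (val a).
apply: filterS => n Hn a aK.
exact: (Hn (Ordinal aK) (in_tuple a)).
Qed.

Lemma cvg_expn_fact (u e : R) : 0 < e -> exists K, `|u ^+ K / K`!%:R| <= e.
Proof.
move=> e0.
have /cvgrPdist_le/(_ e e0)[K _ /(_ K (leqnn K))] := cvg_series_cvg_0 (is_cvg_series_exp_coeff u).
by rewrite sub0r normrN => Ke; exists K.
Qed.

(** The order of choice matters: first [K] makes the Taylor remainder small, then [delta], which
    depends on [K], makes the moment term small. Completeness of [H] concludes. *)
Lemma is_cvg_embedding : cvg (h n @[n --> \oo]).
Proof.
apply: cauchy_cvg; apply: cauchy_exP => e e0.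
have C0 : 0 <= C.
  by have [n _ /(_ n (leqnn n))] := cC; apply: le_trans; apply: sumr_ge0.
pose A := (C + C) ^+ 2 + 1.
have A0 : 0 < A by rewrite ltr_wpDl// sqr_ge0.
have [K KE] : exists K, `|(sigma * d%:R) ^+ K / K`!%:R| <= e ^+ 2 / 4 / A.
  by apply: cvg_expn_fact; rewrite !divr_gt0 ?exprn_gt0.
pose B := (C + C) * taylor_const K.
have B0 : 0 <= B.
  rewrite mulr_ge0 ?addr_ge0// sumr_ge0// => n _.
  by rewrite divr_ge0// exprn_ge0// !mulr_ge0.
(* Two late terms have moments within [2 delta] of each other, hence the final [/ 2]; [B + 1] is
   used as a divisor because [B] may vanish. *)
pose delta := e ^+ 2 / 4 / (B + 1) / 2.
have delta0 : 0 < delta by rewrite !divr_gt0 ?exprn_gt0// ltr_wpDl.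
have [N1 _ N1P] := cC; have [N2 _ N2P] := near_moment K delta0.
pose N := maxn N1 N2; exists (h N); exists N => // n /= Nn.
rewrite -ball_normE/= -(@ltr_pXn2r _ 2)// ?nnegrE ?(ltW e0)//.
have [n1 n2] : (N1 <= n)%N /\ (N2 <= n)%N by apply/andP; rewrite -geq_max.
apply: (@le_lt_trans _ _ ((C + C) ^+ 2 * ((sigma * d%:R) ^+ K / K`!%:R)
    + (delta + delta) * (C + C) * taylor_const K)).
  apply: sqr_dist_embedding_le; [exact/N1P/leq_maxl|exact: N1P|].
  move=> a aK; have m1 := N2P N (leq_maxr _ _) a aK; have m2 := N2P n n2 a aK.
  by rewrite (le_trans (ler_distD (M a) _ _))// lerD// distrC.
have p1 : (C + C) ^+ 2 * ((sigma * d%:R) ^+ K / K`!%:R) <= e ^+ 2 / 4.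
  have := le_trans (ler_norm _) KE; rewrite ler_pdivlMr// mulrC; apply: le_trans.
  rewrite ler_wpM2r ?lerDl// divr_ge0// exprn_ge0// mulr_ge0//.
have p2 : (delta + delta) * (C + C) * taylor_const K <= e ^+ 2 / 4.
  rewrite -mulrA -/B /delta -splitr -[leRHS]mulr1 -mulrA ler_pM2l ?divr_gt0 ?exprn_gt0//.
  by rewrite ler_pdivrMl ?mulr1 ?lerDl// ltr_wpDl.
by rewrite (le_lt_trans (lerD p1 p2))// -mulrDr; have := exprn_gt0 2 e0; lra.
Qed.

(** The section at [x] embeds the Dirac mass at [x], of total mass [1]. Its moments of degree less
    than [m] are the limit moments, so the moment term disappears in the limit and only the Taylor
    remainder of order [m] is left. *)
Lemma sqr_dist_lim_embedding (m : nat) (x : X) :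
  (forall a, (size a < m)%N -> M a = monomial a (val x)) ->
  `|lim (h n @[n --> \oo]) - rkhs_section H x| ^+ 2 <=
  (C + 1) ^+ 2 * ((sigma * d%:R) ^+ m / m`!%:R).
Proof.
move=> Mx; set E := _ * _.
have C0 : 0 <= C.
  by have [n _ /(_ n (leqnn n))] := cC; apply: le_trans; apply: sumr_ge0.
have dcvg : `|h n - rkhs_section H x| ^+ 2 @[n --> \oo] -->
    `|lim (h n @[n --> \oo]) - rkhs_section H x| ^+ 2.
  by apply: cvgM; apply: cvg_norm; apply: cvgB (cvg_cst _); exact: is_cvg_embedding.
have Tx : rkhs_section H x = embedding (fun _ : unit => 1) (fun=> x).
  by rewrite /embedding (big_pred1 tt)// ?scale1r//; case.
apply/ler_addgt0Pr => e e0.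
pose B := (C + 1) * taylor_const m.
have B0 : 0 <= B.
  rewrite mulr_ge0 ?addr_ge0// sumr_ge0// => n _.
  by rewrite divr_ge0// exprn_ge0// !mulr_ge0.
have delta0 : 0 < e / (B + 1) by rewrite divr_gt0// ltr_wpDl.
apply: (cvgr_to_le dcvg); have H1 := cC; have H2 := near_moment m delta0.
near=> n; rewrite Tx.
apply: (@le_trans _ _ (E + e / (B + 1) * (C + 1) * taylor_const m)).
  apply: sqr_dist_embedding_le; first by near: n.
    by rewrite (big_pred1 tt) ?normr1//; case.
  move=> a am; rewrite [X in _ - X]/moment (big_pred1 tt) ?mul1r; last by case.
  by rewrite -Mx//; move: a am; near: n.
rewrite lerD2l -mulrA -/B -mulrA ler_piMr ?(ltW e0)//.
by rewrite ler_pdivrMl ?mulr1 ?lerDl// ltr_wpDl.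
Unshelve. all: by end_near. Qed.

Lemma rkhs_fun_lim_embedding (y : X) (g : R) :
  (\sum_i @c n i * gaussian sigma (val (@z n i)) (val y)) @[n --> \oo] --> g ->
  rkhs_fun (lim (h n @[n --> \oo])) y = g.
Proof.
move=> cg; set l := lim _; set k := rkhs_section H y.
(* Polarization reduces the continuity of the inner product against [k] to that of the norm. *)
have polar (u : H) : rkhs_dot H u k = (`|u + k| ^+ 2 - `|u - k| ^+ 2) / 4.
  rewrite -!rkhs_dotE !(linearDl, linearDr, linearNl, linearNr)/=.
  by rewrite [rkhs_dot H k u]hermC /= mul1r; field.
rewrite rkhs_reproducing -/k; apply/esym.
have : rkhs_dot H (h n) k @[n --> \oo] --> rkhs_dot H l k.
  rewrite polar; under eq_fun do rewrite polar.
  have hl : h n @[n --> \oo] --> l by exact: is_cvg_embedding.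
  have hD u : `|h n + u| ^+ 2 @[n --> \oo] --> `|l + u| ^+ 2.
    by apply: cvgM; apply: cvg_norm; apply: cvgD hl (cvg_cst _).
  apply: cvgMl; exact: cvgB (hD _) (hD _).
under eq_fun do rewrite /h rkhs_dot_embedding.
by move/(cvg_unique _ cg); exact.
Qed.

End DiscreteMeasures.

(** * Riemann sums *)

Section RiemannSum.
Context {R : realType}.
Implicit Types (f g F : R -> R) (n : nat).

Definition riemann_sum n f : R :=
  n.+1%:R^-1 * \sum_(j < n.+1) f (j%:R / n.+1%:R).

Definition lipschitz01 f := exists L : R, forall x y, 0 <= x <= 1 -> 0 <= y <= 1 ->
  `|f x - f y| <= L * `|x - y|.

Lemma lipschitz01_cst (c : R) : lipschitz01 (cst c).
Proof. by exists 0 => x y _ _; rewrite subrr normr0 mul0r. Qed.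

Lemma lipschitz01_id : lipschitz01 id.
Proof. by exists 1 => x y _ _; rewrite mul1r. Qed.

Lemma lipschitz01D f g : lipschitz01 f -> lipschitz01 g -> lipschitz01 (f \+ g).
Proof.
move=> [L fL] [M gM]; exists (L + M) => x y x01 y01 /=.
by rewrite mulrDl opprD addrACA (le_trans (ler_normD _ _))// lerD ?fL ?gM.
Qed.

Lemma lipschitz01_bounded f : lipschitz01 f ->
  exists2 M : R, 0 <= M & forall x, 0 <= x <= 1 -> `|f x| <= M.
Proof.
move=> [L fL]; exists (`|f 0| + `|L|) => [|x x01]; first by rewrite addr_ge0.
rewrite -[f x](subrK (f 0)) addrC (le_trans (ler_normD _ _))// lerD2l.
rewrite (le_trans (fL _ _ x01 _)) ?lexx ?ler01//.
have /andP[x0 x1] := x01; rewrite subr0 (ger0_norm x0) (le_trans (ler_norm _))//.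
by rewrite normrM (ger0_norm x0) ler_piMr.
Qed.

Lemma lipschitz01M f g : lipschitz01 f -> lipschitz01 g -> lipschitz01 (f \* g).
Proof.
move=> lf lg; have [M M0 fM] := lipschitz01_bounded lf.
have [N N0 gN] := lipschitz01_bounded lg.
case: lf lg => [L fL] [K gK]; exists (L * N + M * K) => x y x01 y01 /=.
rewrite (_ : _ - _ = (f x - f y) * g x + f y * (g x - g y)); last by ring.
rewrite (le_trans (ler_normD _ _))// !normrM mulrDl lerD//.
  by rewrite mulrAC ler_pM ?fL ?gN.
by rewrite -mulrA ler_pM ?fM ?gK.
Qed.

Lemma lipschitz01_horner (p : {poly R}) : lipschitz01 (horner p).
Proof.
elim/poly_ind: p => [|p c IH].
  by rewrite (_ : horner _ = cst 0); [exact: lipschitz01_cst|apply/funext => x; rewrite horner0].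
rewrite (_ : horner _ = (horner p \* id) \+ cst c); last first.
  by apply/funext => x; rewrite !hornerE.
by apply: lipschitz01D (lipschitz01_cst _); apply: lipschitz01M lipschitz01_id.
Qed.

(** For [u <= v], factor out [expR (- u) <= 1] and use [1 - expR (u - v) <= v - u]. *)
Lemma expRN_lipschitz (u v : R) : 0 <= u -> 0 <= v -> `|expR (- u) - expR (- v)| <= `|u - v|.
Proof.
wlog uv : u v / u <= v => [H|] u0 v0.
  have [uv|/ltW uv] := leP u v; first exact: H.
  by rewrite distrC (distrC u); exact: H.
rewrite [leRHS]distrC !ger0_norm ?subr_ge0 ?ler_expR ?lerN2//.
have -> : - v = - u + (u - v) by ring.
rewrite expRD -{1}[expR (- u)]mulr1 -mulrBr.
have := expR_ge1Dx (u - v); have : 0 <= expR (- u) <= 1.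
  by rewrite expR_ge0/= -expR0 ler_expR oppr_le0.
have : expR (u - v) <= 1 by rewrite -expR0 ler_expR subr_le0.
by move: (expR (- u)) (expR (u - v)) => a b b1 /andP[a0 a1] ab; nra.
Qed.

Lemma lipschitz01_gaussian1 (sigma y : R) : 0 <= sigma ->
  lipschitz01 (fun z => expR (- (sigma * (z - y) ^+ 2))).
Proof.
move=> s0; pose p : {poly R} := sigma *: ('X - y%:P) ^+ 2.
have pE z : p.[z] = sigma * (z - y) ^+ 2 by rewrite hornerZ horner_exp hornerXsubC.
have [L pL] := lipschitz01_horner p; exists L => x z x01 z01.
have p0 t : 0 <= p.[t] by rewrite pE mulr_ge0// sqr_ge0.
by rewrite -!pE (le_trans (expRN_lipschitz _ _))// pL.
Qed.

(** Telescope [F] over the cells. On each cell the mean value theorem yields some [f c], which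
    differs from the value of [f] at the left endpoint by at most [L / (n + 1)]. *)
Lemma riemann_sum_cvg f F :
  (forall x : R, 0 <= x <= 1 -> is_derive x (1 : R) F (f x)) -> lipschitz01 f ->
  riemann_sum n f @[n --> \oo] --> F 1 - F 0.
Proof.
move=> Ff [L fL].
suff RE n : `|F 1 - F 0 - riemann_sum n f| <= L * n.+1%:R^-1.
  apply/cvgrPdist_le => e e0; near=> n; apply: (le_trans (RE n)).
  have : `|0 - L * n.+1%:R^-1| <= e.
    near: n; move: e e0; apply/cvgrPdist_le.
    by rewrite -(mulr0 L); apply: cvgMr; exact: cvg_harmonic.
  by rewrite sub0r normrN; exact: (le_trans (ler_norm _)).
pose a j : R := j%:R / n.+1%:R.
have N0 : 0 < n.+1%:R :> R by rewrite ltr0n.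
have a01 (j : nat) : (j <= n.+1)%N -> 0 <= a j <= 1.
  by move=> jn; rewrite /a divr_ge0// ler_pdivrMr// mul1r ler_nat.
have -> : F 1 - F 0 = \sum_(j < n.+1) (F (a j.+1) - F (a j)).
  rewrite -(big_mkord xpredT (fun j => F (a j.+1) - F (a j))) telescope_sumr//.
  by rewrite /a mul0r divff// gt_eqF.
rewrite /riemann_sum mulr_sumr -sumrB (le_trans (ler_norm_sum _ _ _))//.
have -> : L / n.+1%:R = \sum_(j < n.+1) L / n.+1%:R / n.+1%:R.
  by rewrite sumr_const card_ord -[RHS]mulr_natr divfK// gt_eqF.
apply: ler_sum => j _; rewrite -/(a j).
have /andP[aj0 _] := a01 j (ltnW (ltn_ord j)).
have /andP[_ aj1] := a01 j.+1 (ltn_ord j).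
have aS : a j.+1 - a j = n.+1%:R^-1 by rewrite /a -mulrBl -natr1 addrC addKr mul1r.
have aa : a j <= a j.+1 by rewrite -subr_ge0 aS invr_ge0 ltW.
have in01 x : x \in `[a j, a j.+1] -> 0 <= x <= 1.
  by rewrite in_itv/= => /andP[h1 h2]; rewrite (le_trans aj0)// (le_trans h2).
have [x xj||c cj ->] := @MVT_segment R F f (a j) (a j.+1) aa.
- by apply/Ff/in01/subset_itv_oo_cc.
- apply: derivable_within_continuous => x /in01 x01.
  by have ? := Ff _ x01; exact: ex_derive.
rewrite aS mulrC -mulrBr normrM ger0_norm ?invr_ge0// mulrC ler_pM2r ?invr_gt0//.
have L0 : 0 <= L.
  by have := fL 1 0; rewrite subr0 normr1 mulr1 !lexx ler01 => /(_ isT isT); exact: le_trans.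
rewrite (le_trans (fL _ _ (in01 _ cj) (in01 _ _)))//; first by rewrite in_itv/= lexx.
rewrite ler_wpM2l// -aS; move: cj; rewrite in_itv/= => /andP[h1 h2].
by rewrite ger0_norm ?subr_ge0// lerB.
Unshelve. all: by end_near. Qed.

Lemma riemann_sum_cvg_poly (p : {poly R}) :
  riemann_sum n (horner p) @[n --> \oo] --> poly_int 0 1 p.
Proof.
apply: (riemann_sum_cvg (F := horner (primitive p))); last exact: lipschitz01_horner.
by move=> x _; apply: is_derive_eq; rewrite deriv_primitive.
Qed.

Lemma riemann_sum_cvg_integral f : continuous f -> lipschitz01 f ->
  riemann_sum n f @[n --> \oo] --> \int[lebesgue_measure]_(x in `[0, 1]) f x.
Proof.
(* The base point [-1], with the bound [2] below, puts [0] and [1] in the interior, where the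
   fundamental theorem of calculus gives a two-sided derivative. *)
move=> cf lf; pose F x := \int[lebesgue_measure]_(t in `[-1, x]) f t.
have dF (x : R) : 0 <= x <= 1 -> is_derive x (1 : R) F (f x).
  move=> /andP[x0 x1].
  have [||||dF <-] := @continuous_FTC1_closed R f (-1) x 2.
  - by rewrite (le_lt_trans x1)// ltr1n.
  - apply: continuous_compact_integrable; first exact: segment_compact.
    exact: continuous_subspaceT.
  - by rewrite (lt_le_trans _ x0)// ltrN10.
  - exact: cf.
  by rewrite derive1E; exact/derivableP.
have -> : \int[lebesgue_measure]_(x in `[0, 1]) f x = F 1 - F 0.
  rewrite /Rintegral (@continuous_FTC2 _ f F) ?ltr01//.
  - exact: continuous_subspaceT.
  - have cF x : 0 <= x <= 1 -> {for x, continuous F}.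
      by move=> /dF ?; apply/differentiable_continuous/derivable1_diffP; exact: ex_derive.
    split.
    + move=> x; rewrite in_itv/= => /andP[x0 x1].
      have ? : is_derive x (1 : R) F (f x) by apply: dF; rewrite !ltW.
      exact: ex_derive.
    + by apply/cvg_at_right_filter/cF; rewrite lexx ler01.
    + by apply/cvg_at_left_filter/cF; rewrite lexx ler01.
  - move=> x; rewrite in_itv/= => /andP[x0 x1].
    have ? : is_derive x (1 : R) F (f x) by apply: dF; rewrite !ltW.
    by rewrite derive1E; exact: derive_val.
exact: riemann_sum_cvg.
Qed.

End RiemannSum.

Lemma continuous_gaussian1 {R : realType} (sigma y : R) :
  continuous (fun z : R => expR (- (sigma * (z - y) ^+ 2))).
Proof.
pose p : {poly R} := - (sigma *: ('X - y%:P) ^+ 2).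
rewrite (_ : (fun _ => _) = expR \o horner p).
  by move=> z; apply: continuous_comp; [exact: continuous_horner|exact: continuous_expR].
by apply/funext => t /=; rewrite hornerN hornerZ horner_exp hornerXsubC.
Qed.

(** * Product Riemann sums on the grid of the cube *)

Section Grid.
Context {R : realType} {d : nat}.

Definition grid_point n (j : {ffun 'I_d -> 'I_n.+1}) : Rd R d :=
  [tuple (j i)%:R / n.+1%:R : measurableTypeR R | i < d].

Lemma grid_point_unit_cube n (j : {ffun 'I_d -> 'I_n.+1}) : unit_cube (grid_point j).
Proof.
move=> i; rewrite tnth_mktuple divr_ge0//= ler_pdivrMr ?ltr0n// mul1r ler_nat.
exact/ltnW/ltn_ord.
Qed.

Lemma sum_grid_prod n (g : 'I_d -> R -> R) :
  \sum_(j : {ffun 'I_d -> 'I_n.+1})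
    \prod_i (n.+1%:R^-1 * g i (tnth (grid_point j) i)) =
  \prod_i riemann_sum n (g i).
Proof.
under [RHS]eq_bigr do rewrite /riemann_sum mulr_sumr.
rewrite bigA_distr_bigA; apply: eq_bigr => j _; apply: eq_bigr => i _.
by rewrite tnth_mktuple.
Qed.

Lemma cvg_prod_ord (u : 'I_d -> nat -> R) (l : 'I_d -> R) :
  (forall i, u i n @[n --> \oo] --> l i) ->
  \prod_i u i n @[n --> \oo] --> \prod_i l i.
Proof.
move=> ul; elim: (index_enum _) => [|i s IH].
  by under eq_fun do rewrite big_nil; rewrite big_nil; exact: cvg_cst.
under eq_fun do rewrite big_cons.
by rewrite big_cons; exact: cvgM.
Qed.

Lemma monomialE (a : seq 'I_d) (z : Rd R d) :
  monomial a z = \prod_i (tnth z i : R) ^+ count_mem i a.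
Proof.
rewrite /monomial; elim: a => [|r a IH] /=.
  by rewrite big_nil big1// => i _; rewrite expr0.
rewrite big_cons IH; under [RHS]eq_bigr do rewrite exprD.
rewrite big_split/=; congr (_ * _).
by rewrite (bigD1 r)//= eqxx expr1 big1 ?mulr1// => i ir; rewrite eq_sym (negPf ir).
Qed.

Context (w : 'I_d -> {poly R}).

(** When [w i] is [w_m^(x_i)], this is the mass at a grid point of the discretization of [W_m^x dP],
    in which the density [p] cancels. *)
Definition grid_weight n (j : {ffun 'I_d -> 'I_n.+1}) : R :=
  \prod_i (n.+1%:R^-1 * (w i).[tnth (grid_point j) i]).

Lemma sum_grid_weight n (g : 'I_d -> R -> R) :
  \sum_(j : {ffun 'I_d -> 'I_n.+1})
    grid_weight j * \prod_i g i (tnth (grid_point j) i) =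
  \prod_i riemann_sum n (horner (w i) \* g i).
Proof.
rewrite -sum_grid_prod; apply: eq_bigr => j _.
by rewrite -big_split/=; apply: eq_bigr => i _; rewrite mulrA.
Qed.

Lemma grid_moment_cvg (a : seq 'I_d) :
  \sum_(j : {ffun 'I_d -> 'I_n.+1}) grid_weight j * monomial a (grid_point j)
  @[n --> \oo] --> \prod_i poly_int 0 1 (w i * 'X^(count_mem i a)).
Proof.
under eq_fun => n.
  under eq_bigr do rewrite monomialE.
  rewrite (sum_grid_weight n (fun i z => z ^+ count_mem i a)).
  over.
apply: cvg_prod_ord => i.
rewrite (_ : (fun _ => _) = riemann_sum ^~ (horner (w i * 'X^(count_mem i a)))).
  exact: riemann_sum_cvg_poly.
apply/funext => n; congr riemann_sum; apply/funext => z /=.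
by rewrite hornerM hornerXn.
Qed.

Lemma grid_gaussian_cvg (sigma : R) (y : Rd R d) : 0 <= sigma ->
  \sum_(j : {ffun 'I_d -> 'I_n.+1}) grid_weight j * gaussian sigma (grid_point j) y
  @[n --> \oo] --> \prod_i \int[lebesgue_measure]_(z in `[0, 1])
    ((w i).[z] * expR (- (sigma * (z - tnth y i) ^+ 2))).
Proof.
move=> s0; under eq_fun => n.
  under eq_bigr do rewrite gaussianE mulr_sumr -sumrN expR_sum.
  rewrite (sum_grid_weight n (fun i z => expR (- (sigma * (z - tnth y i) ^+ 2)))).
  over.
apply: cvg_prod_ord => i.
apply: riemann_sum_cvg_integral.
  by move=> z; apply: cvgM; [exact: continuous_horner|exact: continuous_gaussian1].
by apply: lipschitz01M; [exact: lipschitz01_horner|exact: lipschitz01_gaussian1].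
Qed.

(** A polynomial majorant of [|w i|] with integral at most [m] is used, since Riemann sums of
    polynomials are known to converge; [e] absorbs their error. *)
Lemma near_grid_weight_norm m (e : R) : (0 < m)%N -> 0 < e ->
  (forall i, poly_int 0 1 (w i * w i) <= m%:R ^+ 2) ->
  \forall n \near \oo, \sum_(j : {ffun 'I_d -> 'I_n.+1}) `|grid_weight j| <= m%:R ^+ d + e.
Proof.
move=> m0 e0 wm; have m0' : 0 < m%:R :> R by rewrite ltr0n.
(* AM-GM bounds [|w|] by the polynomial [(w^2 / m + m) / 2]. *)
pose q i : {poly R} := 2^-1 *: (m%:R^-1 *: (w i * w i) + m%:R%:P).
have wq i z : `|(w i).[z]| <= (q i).[z].
  rewrite !(hornerZ, hornerD, hornerM, hornerC).
  rewrite -expr2 -[in leRHS](real_normK (num_real _)); set u := `|_|.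
  rewrite -subr_ge0 (_ : _ - u = (2 * m%:R)^-1 * (u - m%:R) ^+ 2).
    by rewrite mulr_ge0 ?sqr_ge0// invr_ge0 mulr_ge0.
  by field; rewrite gt_eqF.
have q1 : \prod_i poly_int 0 1 (q i) <= m%:R ^+ d.
  have -> : m%:R ^+ d = \prod_(i < d) m%:R :> R by rewrite prodr_const card_ord.
  (* Comparing products needs nonnegative factors; this integral is a limit of Riemann sums of
     [q i], which dominates [|w i|]. *)
  have q0 i : 0 <= poly_int 0 1 (q i).
    apply: (cvgr_to_ge (@riemann_sum_cvg_poly R (q i))); near=> n.
    rewrite mulr_ge0 ?invr_ge0// sumr_ge0// => j _.
    exact: le_trans (wq _ _).
  apply: ler_prod => i _; rewrite q0/= linearZ linearD linearZ/=.
  rewrite poly_int01C.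
  have : m%:R^-1 * poly_int 0 1 (w i * w i) <= m%:R.
    by rewrite ler_pdivrMl// -expr2.
  by rewrite /GRing.scale/=; lra.
have cq : \prod_i riemann_sum n (horner (q i)) @[n --> \oo] --> \prod_i poly_int 0 1 (q i).
  by apply: cvg_prod_ord => i; exact: riemann_sum_cvg_poly.
have /cvgrPdistC_le/(_ e e0) := cq; apply: filterS => n Hn.
apply: (@le_trans _ _ (\prod_i riemann_sum n (horner (q i)))); last first.
  by have := ler_norm (\prod_i riemann_sum n (horner (q i)) - \prod_i poly_int 0 1 (q i)); lra.
rewrite -sum_grid_prod; apply: ler_sum => j _.
rewrite /grid_weight normr_prod; apply: ler_prod => i _.
by rewrite normr_ge0/= normrM ger0_norm ?invr_ge0// ler_wpM2l ?invr_ge0.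
Unshelve. all: by end_near. Qed.

End Grid.

(** * Integration over the unit cube *)

Section IntegralOfProducts.
Context {R : realType}.

Lemma integral_tensor d1 d2 (T1 : measurableType d1) (T2 : measurableType d2)
    (m1 : {sigma_finite_measure set T1 -> \bar R})
    (m2 : {sigma_finite_measure set T2 -> \bar R}) (f : T1 -> R) (g : T2 -> R) :
  m1.-integrable setT (EFin \o f) -> m2.-integrable setT (EFin \o g) ->
  (m1 \x m2)%E.-integrable setT (fun z => (f z.1 * g z.2)%:E) /\
  (\int[m1 \x m2]_z (f z.1 * g z.2)%:E =
   \int[m1]_x (f x)%:E * \int[m2]_y (g y)%:E)%E.
Proof.
move=> intf intg.
have mf : measurable_fun setT f by apply/measurable_EFinP; exact: measurable_int intf.
have mg : measurable_fun setT g by apply/measurable_EFinP; exact: measurable_int intg.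
have mfg : measurable_fun setT (fun z : T1 * T2 => (f z.1 * g z.2)%:E).
  by apply/measurable_EFinP/measurable_funM; exact: measurableT_comp.
have intfg : (m1 \x m2)%E.-integrable setT (fun z => (f z.1 * g z.2)%:E).
  apply/integrable12ltyP => //=.
  under eq_integral => x _.
    under eq_integral do rewrite normrM EFinM.
    rewrite ge0_integralZl//; last first.
      by apply: measurableT_comp => //; exact: measurableT_comp.
    over.
  have /integrableP[_ /= foo] := intf; have /integrableP[_ /= goo] := intg.
  rewrite ge0_integralZr//; last 2 first.
    by apply: measurableT_comp => //; exact: measurableT_comp.
    exact: integral_ge0.
  rewrite lte_mul_pinfty//; first exact: integral_ge0.
  by rewrite ge0_fin_numE//; exact: integral_ge0.
split=> //; rewrite -integral12_prod_meas1// /fubini_F.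
under eq_integral => x _.
  rewrite (_ : (\int[m2]_y _)%E = ((f x)%:E * \int[m2]_y (g y)%:E)%E).
    over.
  by rewrite -integralZl.
have g_fin : (\int[m2]_y (g y)%:E)%E \is a fin_num by exact: integrable_fin_num.
by rewrite -(fineK g_fin) integralZr.
Qed.

(** Integrability is carried along in the induction because Fubini's theorem for a signed integrand
    requires it. *)
Lemma integral_Rd_prod d (f : 'I_d -> R -> R) :
  (forall i, (@lebesgue_measure R).-integrable setT (EFin \o f i)) ->
  (lebesgue_measure_Rd R d).-integrable setT
    (fun z => (\prod_i f i (tnth z i))%:E) /\
  (\int[lebesgue_measure_Rd R d]_z (\prod_i f i (tnth z i))%:E =
   (\prod_i \int[lebesgue_measure]_x f i x)%:E)%E.
Proof.
elim: d f => [|d IH] f intf.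
  under eq_fun do rewrite big_ord0.
  rewrite big_ord0; split.
    apply/integrableP; split; first exact: measurable_cst.
    by rewrite integral_dirac//= diracT mul1e normr1 ltry.
  by rewrite integral_dirac//= diracT mul1e.
have [intg IHg] := IH _ (fun i => intf (lift ord0 i)).
have [intfg fgE] := integral_tensor (intf ord0) intg.
have mP : measurable_fun setT (fun z : Rd R d.+1 => (\prod_i f i (tnth z i))%:E).
  apply/measurable_EFinP/measurable_prod => i _.
  apply: measurableT_comp; last exact: measurable_tnth.
  by apply/measurable_EFinP; exact: measurable_int (intf i).
have PE : (fun z : Rd R d.+1 => (\prod_i f i (tnth z i))%:E) \o @cons_pair R d =
    (fun z => (f ord0 z.1 * \prod_i f (lift ord0 i) (tnth z.2 i))%:E).
  apply/funext => -[x z] /=; rewrite big_ord_recl; congr (_ * _)%:E.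
  by apply: eq_bigr => i _; rewrite /cons_pair tnthS.
split.
  apply: integrable_pushforward => //; first exact: measurable_cons_pair.
  by rewrite preimage_setT PE.
rewrite /= /cons_measure integral_pushforward//; first last.
- by rewrite preimage_setT PE.
- exact: measurable_cons_pair.
rewrite preimage_setT PE fgE IHg big_ord_recl EFinM; congr (_ * _)%E.
by rewrite fineK//; exact: integrable_fin_num (intf ord0).
Qed.

Lemma Rintegral_unit_cube_prod d (f : 'I_d -> R -> R) : (forall i, continuous (f i)) ->
  \int[lebesgue_measure_Rd R d]_(z in @unit_cube R d) (\prod_i f i (tnth z i)) =
  \prod_i \int[lebesgue_measure]_(x in `[0, 1]) f i x.
Proof.
(* Cutting off every factor outside the unit interval cuts off the product outside the cube, where
   some factor vanishes. *)
move=> cf; pose g i := f i \_ `[0, 1].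
have intg i : (@lebesgue_measure R).-integrable setT (EFin \o g i).
  rewrite -restrict_EFin; apply/integrable_restrict => //; rewrite setTI.
  apply: continuous_compact_integrable; first exact: segment_compact.
  exact: continuous_subspaceT.
rewrite Rintegral_mkcond [RHS](eq_bigr (fun i => \int[lebesgue_measure]_x g i x)).
  have [_ gE] := integral_Rd_prod intg.
  rewrite -[RHS]/(fine (\prod_i _)%:E) -gE; congr fine; apply: eq_integral => z _.
  congr EFin; rewrite patchE; case: ifPn => [/set_mem z01|].
    apply: eq_bigr => i _; rewrite /g patchE mem_set//=.
    by rewrite in_itv/=; exact: z01.
  move/negP => z01; have [i zi] : exists i, ~ (0 <= (tnth z i : R) <= 1).
    by apply/existsNP => z01'; apply: z01; exact/mem_set.
  rewrite (bigD1 i)//= /g patchE memNset ?mul0r//=; rewrite in_itv.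
by move=> i _; rewrite Rintegral_mkcond.
Qed.

End IntegralOfProducts.

(** * Constants *)

Section Constants.
Context {R : realType}.

(** From [1 - 1/2 <= expR (- 1/2)] follows [expR (1/2) <= 2], hence [expR 1 <= 4]. *)
Lemma ln6_ge1 : 1 <= ln 6 :> R.
Proof.
rewrite -ler_expR lnK ?posrE//.
have e2 : expR (2^-1) <= 2 :> R.
  have := expR_ge1Dx (- 2^-1 : R); rewrite expRN.
  have := expR_gt0 (2^-1 : R); move: (expR _) => u u0.
  by rewrite -(ler_pM2r u0) mulVf ?gt_eqF//; lra.
rewrite (_ : 1 = 2^-1 + 2^-1 :> R) ?expRD; last by field.
by have := expR_gt0 (2^-1 : R); move: e2; move: (expR _) => u ? ?; nra.
Qed.

(** The exponential series gives [m^m / m! <= e^m], so [u^m / m! <= (e u / m)^m <= v^(- m)]. *)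
Lemma expn_fact_le (u v : R) m : 0 <= u -> 0 < v -> (0 < m)%N ->
  expR 1 * u * v <= m%:R -> u ^+ m / m`!%:R <= expR (- (m%:R * ln v)).
Proof.
move=> u0 v0 m0 uvm; have m0' : 0 < m%:R :> R by rewrite ltr0n.
have mm : m%:R ^+ m / m`!%:R <= expR 1 ^+ m :> R.
  rewrite -expRM_natl mulr1; apply: (@le_trans _ _ (1 + m%:R ^+ m / m`!%:R)).
    by rewrite lerDr.
  by case: m m0 {uvm m0'} => // n _; exact: expR_ge1Dxn.
have uv : expR 1 * u / m%:R <= v^-1.
  by rewrite ler_pdivrMr// -[v^-1]mul1r mulrAC ler_pdivlMr// mul1r.
have -> : expR (- (m%:R * ln v)) = v^-1 ^+ m.
  by rewrite expRN expRM_natl lnK// exprVn.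
have -> : u ^+ m / m`!%:R = (u / m%:R) ^+ m * (m%:R ^+ m / m`!%:R).
  by rewrite mulrA -exprMn divfK// gt_eqF.
apply: (@le_trans _ _ ((u / m%:R) ^+ m * expR 1 ^+ m)).
  by rewrite ler_wpM2l// exprn_ge0// divr_ge0.
rewrite -exprMn lerXn2r ?nnegrE ?mulr_ge0 ?invr_ge0 ?expR_ge0 ?(ltW v0)//.
by rewrite mulrC mulrA.
Qed.

(** With [v = 6 s] in [expn_fact_le] and [m^d + 2 <= 3 m^d], it suffices that
    [2 d ln m + 2 s ln s <= m ln (6 s)]. This follows from [2 d <= s], [ln c <= c - 1] and the two
    bounds on [m]. *)
Lemma error_bound_le (u c s : R) d m : 0 <= u -> 1 <= c -> 2 * expR 1 * u <= c ->
  1 <= s -> 2 * d%:R <= s -> 3 * c * s <= m%:R <= 6 * c * s ->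
  (m%:R ^+ d + 2) ^+ 2 * (u ^+ m / m`!%:R) <= 9 * s `^ (- (2 * s)).
Proof.
move=> u0 c1 uc s1 ds /andP[ms sm].
have s0 : 0 < s by rewrite (lt_le_trans _ s1).
have c0 : 0 < c by rewrite (lt_le_trans _ c1).
have m1 : 1 <= m%:R :> R by nra.
have m0 : (0 < m)%N by rewrite -(ltr0n R) (lt_le_trans _ m1).
have m0' : 0 < m%:R :> R by rewrite ltr0n.
have md1 : 1 <= m%:R ^+ d :> R by rewrite exprn_ege1.
have um : u ^+ m / m`!%:R <= expR (- (m%:R * ln (6 * s))).
  by apply: expn_fact_le; rewrite ?mulr_gt0//; nra.
apply: (@le_trans _ _ ((3 * m%:R ^+ d) ^+ 2 * expR (- (m%:R * ln (6 * s))))).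
  rewrite ler_pM ?sqr_ge0 ?divr_ge0 ?exprn_ge0//.
  by rewrite lerXn2r ?nnegrE ?addr_ge0 ?mulr_ge0 ?exprn_ge0//; lra.
have -> : (3 * m%:R ^+ d) ^+ 2 = 9 * expR (2 * d%:R * ln m%:R) :> R.
  by rewrite exprMn -exprM -natrX -natrM mulnC expRM_natl lnK ?posrE.
rewrite -mulrA ler_pM2l// -expRD /powR gt_eqF// ler_expR mulNr -lerBrDr opprK.
have ls0 : 0 <= ln s by exact: ln_ge0.
have lc : ln c <= c - 1 by have := le_ln1Dx (x := c - 1); rewrite subrKC; apply; lra.
have lm0 : 0 <= ln (m%:R : R) by exact: ln_ge0.
have lmE : ln (m%:R : R) <= ln 6 + ln c + ln s.
  by rewrite -!lnM ?posrE ?mulr_gt0// ler_ln ?posrE ?mulr_gt0.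
have l6 := ln6_ge1.
have ls6 : ln (6 * s) = ln 6 + ln s by rewrite lnM ?posrE.
rewrite ls6.
apply: (@le_trans _ _ (3 * c * s * (ln 6 + ln s) - 2 * s * ln s)); last first.
  by rewrite [leRHS]addrC lerD2r ler_wpM2r// addr_ge0// (le_trans ler01).
apply: (@le_trans _ _ (s * ln m%:R)); first by rewrite ler_wpM2r.
apply: (@le_trans _ _ (s * (ln 6 + (c - 1) + ln s))).
  by rewrite ler_wpM2l ?(ltW s0)//; lra.
rewrite -subr_ge0.
have -> : 3 * c * s * (ln 6 + ln s) - 2 * s * ln s - s * (ln 6 + (c - 1) + ln s) =
  s * ((c - 1) * (ln 6 - 1) + 2 * c * ln 6 + 3 * (c - 1) * ln s) by ring.
rewrite mulr_ge0 ?(ltW s0)// !addr_ge0// !mulr_ge0//; lra.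
Qed.

Context {d : nat}.

Lemma unit_cube0 : @unit_cube R d [tuple (0 : measurableTypeR R) | _ < d].
Proof. by move=> i; rewrite tnth_mktuple lexx ler01. Qed.

Lemma measurable_unit_cube : measurable (@unit_cube R d).
Proof.
rewrite (_ : unit_cube (d:=d) = \bigcap_(i in [set: 'I_d])
    ((fun z : Rd R d => tnth z i) @^-1` `[0, 1])).
  apply: fin_bigcap_measurable => // i _.
  by rewrite -[X in measurable X]setTI; exact: measurable_tnth.
apply/seteqP; split => z /= z01 i; first by move=> _; rewrite /= in_itv; exact: z01.
by have := z01 i I; rewrite /= in_itv.
Qed.

Lemma lebesgue_measure_unit_cube : lebesgue_measure_Rd R d (@unit_cube R d) = 1%E.
Proof.
rewrite (_ : unit_cube (d:=d) = [set z | forall i, `[0, 1]%classic (tnth z i)]); last first.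
  by apply/seteqP; split => z /= z01 i; have := z01 i; rewrite in_itv.
rewrite (lebesgue_measure_Rd_box (A := fun=> `[0, 1]%classic))// big1// => i _.
by rewrite lebesgue_measure_itv/= lte_fin ltr01 sube0.
Qed.

Lemma density_gt0 (p : Rd R d -> R) :
  (0 < ereal_inf [set (p z)%:E | z in @unit_cube R d])%E ->
  exists2 e, 0 < e & forall z, unit_cube z -> e <= p z.
Proof.
set I := ereal_inf _ => I0.
have Ip z : unit_cube z -> (I <= (p z)%:E)%E.
  by move=> z01; apply: ereal_inf_lbound; exists z.
have := Ip _ unit_cube0; move: I I0 Ip => [e| |]// e0 Ip _.
by exists e => // z /Ip; rewrite lee_fin.
Qed.

(** If [c_p p < 1], then [p >= (c_p p)^-1 > 1] on a cube of volume [1], and [P] would have mass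
    above [1]. The positive lower bound on [p] bounds the set of inverses, so that its [sup] is an
    upper bound. *)
Lemma c_p_ge1 (P : probability (Rd R d) R) (p : Rd R d -> R) : has_density P p ->
  (0 < ereal_inf [set (p z)%:E | z in @unit_cube R d])%E -> 1 <= c_p p.
Proof.
move=> [mp PE] /density_gt0[e e0 ep]; rewrite leNgt; apply/negP => cp1.
have ub z : unit_cube z -> (p z)^-1 <= c_p p.
  move=> z01; apply: sup_ubound; last by exists z.
  exists e^-1 => _ [y /ep y01 <-].
  by rewrite lef_pV2// ?posrE// (lt_le_trans e0).
have cp0 : 0 < c_p p.
  rewrite (lt_le_trans _ (ub _ unit_cube0))// invr_gt0 (lt_le_trans e0)// ep//.
  exact: unit_cube0.
have : ((c_p p)^-1%:E <= 1)%E.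
  rewrite -(probability_setT P) PE// setTI -[leLHS]mule1 -lebesgue_measure_unit_cube.
  rewrite -integral_cst; last exact: measurable_unit_cube.
  apply: ge0_le_integral => //.
  - exact: measurable_unit_cube.
  - by move=> z _; rewrite lee_fin invr_ge0 ltW.
  - by apply/measurable_EFinP.
  move=> z z01; rewrite lee_fin -[leRHS]invrK lef_pV2 ?posrE ?invr_gt0 ?ub//.
  by rewrite (lt_le_trans e0)// ep.
by rewrite lee_fin invf_le1// leNgt cp1.
Qed.

(** Already [c1 >= 2]: the numerator in it is at least [d (ln 2 + ln 3) >= d], because
    [2 d - 1 >= d], [c_sigma >= 1] and [ln c_p >= 0]. *)
Lemma c_threshold_ge2 (sigma t : R) (p : Rd R d -> R) : (1 <= d)%N -> 1 <= c_p p ->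
  c_threshold sigma p <= t -> 2 <= t.
Proof.
move=> d1 cp1; rewrite /c_threshold !ge_max => /andP[/andP[_ c1t] _].
apply: le_trans c1t; have d0 : 1 <= d%:R :> R by rewrite ler1n.
have cs1 : 1 <= c_sigma d sigma by rewrite /c_sigma le_max lexx.
have l6 := ln6_ge1; rewrite (_ : 6 = 2 * 3 :> R) ?lnM ?posrE// in l6; last by ring.
have l2 : 0 <= ln 2 :> R by apply: ln_ge0; lra.
have lcp : 0 <= ln (c_p p) by exact: ln_ge0.
have l3 : ln 3 <= ln (3 * c_sigma d sigma) by rewrite ler_ln ?posrE; lra.
rewrite /c1 -lerBlDr ler_pdivlMr ?(lt_le_trans ltr01)//.
move: (ln 2) (ln 3) (ln (c_p p)) (ln (3 * _)) l6 l2 lcp l3 => a b e f l6 l2 lcp l3.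
by nra.
Qed.

(** With [x = 3 c_sigma s], the degree lies between [x] and [x + 3 <= 2 x], as [x >= 3]. *)
Lemma degree_bounds (sigma s : R) : 1 <= s ->
  3 * c_sigma d sigma * s <= (degree d sigma s)%:R <= 6 * c_sigma d sigma * s.
Proof.
move=> s1; have c1 : 1 <= c_sigma d sigma by rewrite /c_sigma le_max lexx.
rewrite /degree natrD; set x := 3 * _ * s.
have x3 : 3 <= x by rewrite /x; nra.
have /andP[lo hi] := ceil_itv x.
have -> : `|Num.ceil x|%:R = (Num.ceil x)%:~R :> R.
  rewrite natr_absz ger0_norm// -(ler_int R); apply: le_trans hi; lra.
by move: lo; rewrite intrD; rewrite (_ : 6 * _ * s = 2 * x); last (rewrite /x; ring); lra.
Qed.

End Constants.

(** * The interpolation weights *)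

Section HilbertWeights.
Context {R : realType} (m : nat) (v : 'cV[R]_m) (x : R).
Hypothesis hv : hilbert_mx R m *m v = moments m x.

Definition weight_poly : {poly R} := \sum_(i < m) v i 0 *: 'X^i.

Lemma weight_polyE (z : R) : weight1 v z = weight_poly.[z].
Proof.
rewrite /weight1 horner_sum; apply: eq_bigr => i _.
by rewrite hornerZ hornerXn.
Qed.

Lemma size_weight_poly : (size weight_poly <= m)%N.
Proof.
apply: (leq_trans (size_sum _ _ _)); apply/bigmax_leqP => i _.
by rewrite (leq_trans (size_scale_leq _ _))// size_polyXn.
Qed.

(** The integral of ['X^(i + k)] is the entry [(k, i)] of the Hilbert matrix, so this is row [k] of
    the system. *)
Lemma poly_int_weight_Xn k : (k < m)%N -> poly_int 0 1 (weight_poly * 'X^k) = x ^+ k.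
Proof.
move=> km; have /matrixP/(_ (Ordinal km) 0) := hv; rewrite !mxE => <-.
rewrite mulr_suml linear_sum; apply: eq_bigr => i _.
by rewrite mxE -scalerAl -exprD linearZ /= poly_int01Xn mulrC addnC.
Qed.

(** The weight has degree less than [m], so it reproduces itself at [x]. *)
Lemma poly_int_weight_sqr : poly_int 0 1 (weight_poly * weight_poly) = weight_poly.[x].
Proof.
rewrite {2}/weight_poly mulr_sumr linear_sum /= horner_sum; apply: eq_bigr => i _.
by rewrite -scalerAr linearZ /= poly_int_weight_Xn// hornerZ hornerXn.
Qed.

Lemma poly_int_weight_sqr_le : (0 < m)%N -> 0 <= x <= 1 ->
  poly_int 0 1 (weight_poly * weight_poly) <= m%:R ^+ 2.
Proof.
move=> m0 x01.
by apply: (evaluation_norm_le m0 size_weight_poly x01); exact: poly_int_weight_sqr.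
Qed.

End HilbertWeights.

(** * The RKHS error of the interpolation weights *)

Lemma rkhs_norm_le (R : realType) (X : Type) (k : X -> X -> R) (H : rkhs k)
    (h : H) (f : X -> R) (B : R) :
  rkhs_fun h = f -> `|h| ^+ 2 <= B -> (rkhs_norm H f ^+ 2 <= B%:E)%E.
Proof.
move=> hf hB; have n0 : (0 <= rkhs_norm H f)%E.
  by apply: le_ereal_inf_tmp => _ [g _ <-]; rewrite lee_fin.
apply: (@le_trans _ _ (`|h|%:E ^+ 2)%E); last by rewrite -EFin_expe lee_fin.
by rewrite lee_sqr// ?lee_fin//; apply: ereal_inf_lbound; exists h.
Qed.

(** The density cancels against its inverse and the Gaussian factors over the coordinates, so
    Fubini's theorem applies. *)
Lemma integral_operator_weight (R : realType) (d : nat) (sigma : R) (p : Rd R d -> R)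
    (m : nat) (alpha : R -> 'cV[R]_m) (x y : Rd R d) :
  (forall z, unit_cube z -> p z != 0) ->
  integral_operator (gaussian sigma) p (weight alpha p x) y =
  \prod_i \int[lebesgue_measure]_(z in `[0, 1])
    ((weight_poly (alpha (tnth x i))).[z] * expR (- (sigma * (z - tnth y i) ^+ 2))).
Proof.
move=> p0; rewrite /integral_operator -Rintegral_unit_cube_prod; last first.
  move=> i z; apply: cvgM; first exact: continuous_horner.
  exact: continuous_gaussian1.
apply: eq_Rintegral => z /set_mem z01.
rewrite /weight -mulrA mulfVK ?p0// gaussianE /sqdist mulr_sumr -sumrN expR_sum mulrC.
by rewrite -big_split; apply: eq_bigr => i _; rewrite weight_polyE.
Qed.

Unset Implicit Arguments.

Theorem proposition3p2 (R : realType) (d : nat) (sigma : R)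
    (P : probability (Rd R d) R) (p : Rd R d -> R)
    (H : rkhs (fun x y : @unit_cube R d => gaussian sigma (val x) (val y)))
    (t : R) (alpha : R -> 'cV[R]_(degree d sigma (t * d%:R))) :
  (1 <= d)%N ->
  0 < sigma ->
  has_density P p ->
  (0 < ereal_inf [set (p z)%:E | z in @unit_cube R d])%E ->
  (ereal_sup [set (p z)%:E | z in @unit_cube R d] < +oo)%E ->
  (forall x : R, 0 <= x <= 1 ->
    hilbert_mx R (degree d sigma (t * d%:R)) *m alpha x
    = moments (degree d sigma (t * d%:R)) x) ->
  c_threshold sigma p <= t ->
  (ereal_sup [set rkhs_norm H (fun y : @unit_cube R d =>
       (integral_operator (gaussian sigma) p (weight alpha p x) (val y)
        - gaussian sigma x (val y))%R) ^+ 2 | x in @unit_cube R d]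
   <= (9 * (t * d%:R) `^ (- (2 * t * d%:R)))%:E)%E.
Proof.
move=> d1 sigma0 Pp p_inf p_sup alphaE ct.
have [e e0 ep] := density_gt0 p_inf.
have p0 z : unit_cube z -> p z != 0.
  by move=> /ep epz; rewrite gt_eqF// (lt_le_trans e0).
(* This is what gives [2 d <= t d], required by [error_bound_le]. *)
have t2 := c_threshold_ge2 d1 (c_p_ge1 Pp p_inf) ct.
have d1' : 1 <= d%:R :> R by rewrite ler1n.
have s1 : 1 <= t * d%:R by nra.
have mb := @degree_bounds R d sigma _ s1.
set m := degree d sigma (t * d%:R) in alpha alphaE mb *.
have m0 : (0 < m)%N by rewrite /m /degree addn2.
apply: ge_ereal_sup => _ [x x01 <-].
pose w i := weight_poly (alpha (tnth x i)).
have ax i : hilbert_mx R m *m alpha (tnth x i) = moments m (tnth x i).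
  exact: alphaE.
pose X : Type := @unit_cube R d.
pose xX : X := exist _ x (mem_set x01).
pose z n (j : {ffun 'I_d -> 'I_n.+1}) : X :=
  exist _ (grid_point j) (mem_set (grid_point_unit_cube j)).
pose h n : H := embedding H (@grid_weight R d w n) (@z n).
pose M (a : seq 'I_d) := \prod_i poly_int 0 1 (w i * 'X^(count_mem i a)).
have TV : \forall n \near \oo,
    \sum_(j : {ffun 'I_d -> 'I_n.+1}) `|grid_weight w j| <= m%:R ^+ d + 1.
  by apply: near_grid_weight_norm => // i; apply: poly_int_weight_sqr_le.
have momM a : moment (@grid_weight R d w n) (@z n) a @[n --> \oo] --> M a.
  exact: grid_moment_cvg.
(* The exponent of each variable is at most [size a < m], so each one-dimensional weight reproduces
   that power. *)
have Mx a : (size a < m)%N -> M a = monomial a (val xX).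
  move=> am; rewrite monomialE; apply: eq_bigr => i _.
  by rewrite (poly_int_weight_Xn (ax i))// (leq_ltn_trans (count_size _ _)).
have hx := sqr_dist_lim_embedding (ltW sigma0) H TV momM Mx.
apply: (@rkhs_norm_le _ _ _ H (lim (h n @[n --> \oo]) - rkhs_section H xX)).
  apply/funext => y; rewrite addrC -scaleN1r rkhs_funP rkhs_sectionE mulN1r addrC.
  congr (_ - _); apply: (rkhs_fun_lim_embedding (ltW sigma0) H TV momM).
  rewrite integral_operator_weight//.
  exact: grid_gaussian_cvg (ltW sigma0).
(* The slack [1] in [TV] and the mass [1] of the Dirac at [x] combine into [m^d + 2]. *)
apply: (le_trans hx); rewrite -addrA -[1 + 1]/(2%:R) -mulrA.
apply: error_bound_le mb => //.
- by rewrite mulr_ge0// ltW.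
- by rewrite /c_sigma le_max lexx.
- by rewrite /c_sigma le_max !mulrA lexx orbT.
- by nra.
Qed.
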